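(* There exist absolute constants $0<C_1\le C_2$ such that the following holds. For all integers $k\ge 2$, $r\ge 1$ and $n\ge k(10r)^{9r}$, there exists a real number $c$ with $C_1\, r^{-9}k^{1/r-2}\le c\le C_2\, r^{-9}k^{1/r-2}$ such that $$\mathrm{LCS}(r+k+2,[k]^n)\ \ge\ \frac{n}{k}+c\,n^{1-\frac1r}.$$
   Context: $[k]=\{1,2,\ldots,k\}$ is the canonical $k$-letter alphabet, and $[k]^n$ is the set of all words (finite sequences of symbols) of length $n$ over $[k]$. A subsequence of a word $w$ is any word obtained from $w$ by deleting zero or more symbols (not necessarily consecutive ones). A common subsequence of $w$ and $w'$ is a word that is a subsequence of both; $\mathrm{LCS}(w,w')$ denotes the length of a longest common subsequence of $w$ and $w'$. For a finite multiset $\mathcal{W}$ of words, $\mathrm{LCS}(\mathcal{W})=\max \mathrm{LCS}(w,w')$, the maximum being over all pairs $\{w,w'\}$ in $\mathcal{W}$; that is, for $\mathcal{W}=(w^{(1)},\ldots,w^{(t)})$ with repetitions allowed, $\mathrm{LCS}(\mathcal{W})=\max_{1\le i<j\le t}\mathrm{LCS}(w^{(i)},w^{(j)})$. For an integer $t\ge2$ and a family $\mathcal{F}$ of words, $\mathrm{LCS}(t,\mathcal{F})=\min_{\mathcal{W}\in\mathcal{F}^t}\mathrm{LCS}(\mathcal{W})$. *)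

(* Defs.v *)
From HB Require Import structures.
From mathcomp Require Import all_boot all_order all_algebra.
From mathcomp Require Import reals exp.

Set Implicit Arguments.
Unset Strict Implicit.
Unset Printing Implicit Defensive.

(* A common subsequence of w and w' has length at most [size w], so bounding
   the range of m loses nothing. *)
Definition LCS (T : finType) (w w' : seq T) : nat :=
  \max_(m < (size w).+1 |
        [exists s : m.-tuple T, subseq s w && subseq s w']) m.

(* Multisets are represented by tuples: pairs are pairs of distinct indices,
   so a word occurring twice is also paired with its copy. *)
Definition LCS_multiset (T : finType) (n t : nat)
    (W : t.-tuple (n.-tuple T)) : nat :=
  \max_(i < t) \max_(j < t | i < j) LCS (tnth W i) (tnth W j).

(* Since [LCS_multiset W <= n] for words of length n, the default value n of
   the iterated minimum does not affect the result when F is nonempty. *)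
Definition LCS_family (T : finType) (n t : nat) (F : {set n.-tuple T}) : nat :=
  \big[minn/n]_(W : t.-tuple (n.-tuple T) | all [in F] W) LCS_multiset W.

(* [k]^n, with the k letters taken to be 0, ..., k-1. *)
Definition words (k n : nat) : {set n.-tuple 'I_k} := [set: n.-tuple 'I_k].

(* Main.v *)
Require Import Defs.
From HB Require Import structures.
From mathcomp Require Import all_boot all_order all_algebra.
From mathcomp Require Import reals exp.
From mathcomp Require Import zify ring lra.
Import Order.TTheory GRing.Theory Num.Theory.

Set Implicit Arguments.
Unset Strict Implicit.
Unset Printing Implicit Defensive.

(* Let U be the LCS of the family. At most k of the words contain some letter
   more than U times, so r + 2 words remain in which each of two fixed letters a
   and b occurs at least M = n - (k - 1) U times. It suffices that two of these
   have LCS > M + G, where G has order (n / k)^(1 - 1/r) up to powers of r.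
   Suppose not, and cut each word into M cells, each consisting of an a and the
   b's that follow it. Matching a's cell by cell gives M letters; on an interval
   of l cells one may instead match b's, which gains when both words have more
   than l b's there; shifting one word by d cells costs only d. Averaging over
   the shifts d < q l shows that in most blocks of q l cells at most one word has
   a substantial total excess of b's over its sub-blocks of l cells.
   Now descend through the scales q^(r-1), ..., q, 1. In each block of length
   q^(r-1), all but two words have almost as many b's as cells. At each scale,
   discarding the word of largest excess keeps this property for the sub-blocks.
   After r - 2 steps two words survive in blocks of length q, both with about q
   b's, and the averaging argument with l = 1 yields the contradiction. This
   needs r >= 2; for r = 1, two of three words have the same first letter among
   a and b. *)

(** * Words on two letters as sequences of cells *)

Lemma leq_LCS (T : finType) (s w w' : seq T) :
  subseq s w -> subseq s w' -> size s <= LCS w w'.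
Proof.
move=> sw sw'; have lt_s : size s < (size w).+1 by rewrite ltnS size_subseq.
apply: (@leq_bigmax_cond _ _ (fun m : 'I__ => m : nat) (Ordinal lt_s)).
by apply/existsP; exists (in_tuple s); rewrite sw sw'.
Qed.

Definition cells (T : Type) (a b : T) (g : nat -> nat) (z n : nat) : seq T :=
  flatten [seq a :: nseq (g c) b | c <- iota z n].

(* Up to letters other than a and b, every word has this form; [ones g0 g z] is
   the number of b's before the a of index z. *)
Definition encode (T : Type) (a b : T) (g0 : nat) (g : nat -> nat) (n : nat) :=
  nseq g0 b ++ cells a b g 0 n.

Definition ones (g0 : nat) (g : nat -> nat) (z : nat) : nat :=
  g0 + \sum_(0 <= c < z) g c.

Lemma cellsD (T : Type) (a b : T) g z m n :
  cells a b g z (m + n) = cells a b g z m ++ cells a b g (z + m) n.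
Proof. by rewrite /cells iotaD map_cat flatten_cat. Qed.

Lemma cellsS (T : Type) (a b : T) g z n :
  cells a b g z n.+1 = a :: nseq (g z) b ++ cells a b g z.+1 n.
Proof. by []. Qed.

(** A prepended a opens a new cell, and the initial run of b's becomes the gap of that cell. *)
Lemma encode_shift (T : Type) (a b : T) g0 g n :
  a :: encode a b g0 g n =
  encode a b 0 (fun c => if c is c'.+1 then g c' else g0) n.+1.
Proof.
rewrite /encode cellsS /= /cells -[1]addn0 iotaDl -map_comp; congr (_ :: _ ++ _).
Qed.

Lemma ones_shift g0 g z :
  ones 0 (fun c => if c is c'.+1 then g c' else g0) z.+1 = ones g0 g z.
Proof. by rewrite /ones add0n big_nat_recl. Qed.

(** Reading from the right, an a opens a cell, a b lengthens the initial run, and any other letter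
    is dropped. *)
Lemma exists_encode (T : eqType) (a b : T) (w : seq T) : a != b ->
  exists g0 g, subseq (encode a b g0 g (count_mem a w)) w /\
    ones g0 g (count_mem a w) = count_mem b w.
Proof.
move=> neq_ab; elim: w => [|x w [g0 [g [sub_w onesE]]]].
  by exists 0, (fun=> 0); rewrite /ones big_geq.
case: (eqVneq x a) => [->|neq_xa].
  exists 0, (fun c => if c is c'.+1 then g c' else g0).
  have ->: count_mem a (a :: w) = (count_mem a w).+1 by rewrite /= eqxx.
  rewrite ones_shift -encode_shift; split; first by rewrite /= eqxx.
  by rewrite onesE /= (negPf neq_ab).
case: (eqVneq x b) => [->|neq_xb].
  exists g0.+1, g; rewrite /= eqxx eq_sym (negPf neq_ab) add0n -onesE.
  by split; rewrite ?/ones ?addSn.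
exists g0, g; rewrite /= (negPf neq_xa) (negPf neq_xb) !add0n.
by split=> //; apply: subseq_trans sub_w (subseq_cons _ _).
Qed.

Lemma nseq_subseq_cells (T : eqType) (a b : T) g z n :
  subseq (nseq n a) (cells a b g z n).
Proof.
elim: n z => [|n IHn] z; first exact: sub0seq.
by rewrite cellsS /= eqxx; apply: subseq_trans (IHn z.+1) (suffix_subseq _ _).
Qed.

Lemma nseq_subseq_cells_gaps (T : eqType) (a b : T) g z n :
  subseq (nseq (\sum_(z <= c < z + n) g c) b) (cells a b g z n).
Proof.
elim: n z => [|n IHn] z; first by rewrite addn0 big_geq.
rewrite cellsS addnS big_ltn ?ltnS ?leq_addr // nseqD -addSn.
apply: subseq_trans (subseq_cons _ _); apply: cat_subseq => //; exact: IHn.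
Qed.

Lemma cons_nseq_subseq_cells (T : eqType) (a b : T) g z n : 0 < n ->
  subseq (a :: nseq (\sum_(z <= c < z + n) g c) b) (cells a b g z n).
Proof.
case: n => // n _; rewrite cellsS addnS big_ltn ?ltnS ?leq_addr // nseqD -addSn.
rewrite /= eqxx; apply: cat_subseq => //; exact: nseq_subseq_cells_gaps.
Qed.

(* Matching b's instead of a's on a block of l cells keeps the a that opens the
   block, hence the successor. *)
Definition excess (o : nat -> nat) (l k : nat) : nat :=
  (o (k.+1 * l) - o (k * l)).+1 - l.

(** The shortage of b's against the l a's of the block. If the block has c b's, then
    [deficit + c <= excess + l]. *)
Definition deficit (o : nat -> nat) (l k : nat) : nat :=
  l - (o (k.+1 * l) - o (k * l)).

Definition block_excess (o : nat -> nat) (l q B : nat) : nat :=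
  \sum_(0 <= t < q) excess o l (B * q + t).

Lemma homo_ones g0 g : {homo ones g0 g : x y / x <= y}.
Proof.
move=> x y le_xy; rewrite /ones leq_add2l (@big_cat_nat _ _ _ x 0 y) //=.
exact: leq_addr.
Qed.

Lemma sum_gaps g0 g x y : x <= y ->
  \sum_(x <= c < y) g c = ones g0 g y - ones g0 g x.
Proof.
move=> le_xy; rewrite /ones (@big_cat_nat _ _ _ x 0 y) //= addnA.
by rewrite addnC addnK.
Qed.

Lemma nseq_subseq_encode (T : eqType) (a b : T) g0 g z :
  subseq (nseq (ones g0 g z) b) (encode a b g0 g z).
Proof.
rewrite /ones nseqD; apply: cat_subseq => //.
exact: (nseq_subseq_cells_gaps a b g 0 z).
Qed.

Lemma encodeD (T : Type) (a b : T) g0 g m n :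
  encode a b g0 g (m + n) = encode a b g0 g m ++ cells a b g m n.
Proof. by rewrite /encode cellsD catA. Qed.

Lemma subseq_nseq_leq (T : eqType) (a : T) m n s :
  m <= n -> subseq (nseq n a) s -> subseq (nseq m a) s.
Proof.
by move=> le_mn; apply: subseq_trans; rewrite -(subnKC le_mn) nseqD prefix_subseq.
Qed.

(** * Common subsequences of two encoded words *)

Section TwoWords.
Variables (T : finType) (a b : T) (w w' : seq T).
Variables (g0 g0' : nat) (g g' : nat -> nat) (Z Z' M : nat).
Hypothesis sub_w : subseq (encode a b g0 g Z) w.
Hypothesis sub_w' : subseq (encode a b g0' g' Z') w'.
Hypotheses (leMZ : M <= Z) (leMZ' : M <= Z').

(** Common subsequence: the b's before cell z, then [M - z] a's. So two words cannot both be far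
    ahead in b's at z. *)
Lemma LCS_ones_zeros z : z <= M ->
  minn (ones g0 g z) (ones g0' g' z) + M <= z + LCS w w'.
Proof.
move=> le_zM; set m := minn _ _.
suff : m + (M - z) <= LCS w w' by lia.
have sub v e0 e Y : subseq (encode a b e0 e Y) v -> M <= Y -> m <= ones e0 e z ->
    subseq (nseq m b ++ nseq (M - z) a) v.
  move=> sub_v leMY le_m; apply: subseq_trans sub_v.
  rewrite -(subnKC (leq_trans le_zM leMY)) encodeD; apply: cat_subseq.
    exact: subseq_nseq_leq le_m (nseq_subseq_encode _ _ _ _ _).
  apply: subseq_nseq_leq (nseq_subseq_cells _ _ _ _ _); lia.
have := leq_LCS (sub _ _ _ _ sub_w leMZ (geq_minl _ _))
                (sub _ _ _ _ sub_w' leMZ' (geq_minr _ _)).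
by rewrite size_cat !size_nseq.
Qed.

(** Common subsequence: z a's, then the b's from cell z on. So two words cannot both be far behind
    in b's at z. *)
Lemma LCS_zeros_ones z : M <= ones g0 g Z -> M <= ones g0' g' Z' -> z <= M ->
  z + M <= maxn (ones g0 g z) (ones g0' g' z) + LCS w w'.
Proof.
move=> leMo leMo' le_zM; set m := maxn _ _.
suff : z + (M - m) <= LCS w w' by lia.
have sub v e0 e Y : subseq (encode a b e0 e Y) v -> M <= Y -> M <= ones e0 e Y ->
    ones e0 e z <= m -> subseq (nseq z a ++ nseq (M - m) b) v.
  move=> sub_v leMY leMe le_m; apply: subseq_trans sub_v.
  have le_zY := leq_trans le_zM leMY.
  rewrite -[in encode _ _ _ _ Y](subnKC le_zY) encodeD; apply: cat_subseq.
    apply: subseq_trans (suffix_subseq _ _); exact: nseq_subseq_cells.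
  apply: subseq_nseq_leq (nseq_subseq_cells_gaps _ _ _ _ _).
  by rewrite subnKC // (sum_gaps e0) //; lia.
have := leq_LCS (sub _ _ _ _ sub_w leMZ leMo (leq_maxl _ _))
                (sub _ _ _ _ sub_w' leMZ' leMo' (leq_maxr _ _)).
by rewrite size_cat !size_nseq.
Qed.

(** In each pair of blocks match l a's, or one a and then b's if both excesses are positive; the t
    remaining cells give a's. *)
Lemma LCS_cells_blocks (x x' l n t : nat) : 0 < l ->
  exists2 s, size s = n * l + t +
    \sum_(0 <= k < n)
      minn (excess (ones g0 g) l (x + k)) (excess (ones g0' g') l (x' + k)) &
    subseq s (cells a b g (x * l) (n * l + t)) /\
    subseq s (cells a b g' (x' * l) (n * l + t)).
Proof.
move=> l_gt0; elim: n x x' => [|n IHn] x x'.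
  exists (nseq t a); first by rewrite size_nseq big_geq // addn0.
  by split; exact: nseq_subseq_cells.
have [s size_s [sub_s sub_s']] := IHn x.+1 x'.+1.
set e := minn (excess (ones g0 g) l x) (excess (ones g0' g') l x').
have [s1 size_s1 [sub_s1 sub_s1']] : exists2 s1, size s1 = l + e &
    subseq s1 (cells a b g (x * l) l) /\ subseq s1 (cells a b g' (x' * l) l).
  have [e0|e_gt0] := posnP e.
    exists (nseq l a); first by rewrite size_nseq e0 addn0.
    by split; exact: nseq_subseq_cells.
  exists (a :: nseq (l + e).-1 b); first by rewrite /= size_nseq prednK // addn_gt0 l_gt0.
  have sub f f0 y : e <= excess (ones f0 f) l y ->
      subseq (a :: nseq (l + e).-1 b) (cells a b f (y * l) l).
    move=> le_e; apply: subseq_trans (cons_nseq_subseq_cells _ _ _ _ l_gt0).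
    rewrite /= eqxx; apply: subseq_nseq_leq (subseq_refl _).
    move: le_e; rewrite (sum_gaps f0) ?leq_addr // /excess mulSn (addnC l); lia.
  by split; [apply: (sub g g0); exact: geq_minl|apply: (sub g' g0'); exact: geq_minr].
exists (s1 ++ s).
  rewrite size_cat size_s1 size_s big_nat_recl // !addn0 -/e mulSn.
  under [in RHS]eq_bigr do rewrite !addnS -!addSn.
  lia.
by split; rewrite mulSn -addnA cellsD -mulSnr; apply: cat_subseq.
Qed.

(** Block k of w is matched with block [k + d] of w'; skipping the first [d * l] cells of w' is the
    only loss. *)
Lemma LCS_shifted_blocks (l K d : nat) : 0 < l -> K * l <= M -> d <= K ->
  M + \sum_(0 <= k < K - d)
    minn (excess (ones g0 g) l k) (excess (ones g0' g') l (k + d)) <= d * l + LCS w w'.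
Proof.
move=> l_gt0 le_KM le_dK.
have [s size_s [sub_s sub_s']] := @LCS_cells_blocks 0 d l (K - d) (M - K * l) l_gt0.
have le_dlK : d * l <= K * l by rewrite leq_mul2r le_dK orbT.
have sizeE : (K - d) * l + (M - K * l) = M - d * l by rewrite mulnBl; lia.
rewrite sizeE in size_s sub_s sub_s'.
have sub_sw : subseq s w.
  apply: subseq_trans sub_w.
  rewrite -(subnKC (leq_trans (leq_subr (d * l) M) leMZ)) encodeD.
  apply: subseq_trans (prefix_subseq _ _); apply: subseq_trans (suffix_subseq _ _).
  exact: sub_s.
have sub_sw' : subseq s w'.
  apply: subseq_trans sub_w'; rewrite -(subnKC leMZ') encodeD.
  apply: subseq_trans (prefix_subseq _ _).
  rewrite -(subnKC (leq_trans le_dlK le_KM)) encodeD.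
  by apply: subseq_trans (suffix_subseq _ _).
have := leq_LCS sub_sw sub_sw'; rewrite size_s.
rewrite (eq_bigr (fun k => minn (excess (ones g0 g) l k)
  (excess (ones g0' g') l (k + d)))) => [|k _]; last by rewrite add0n (addnC d).
lia.
Qed.
End TwoWords.

(** * Averaging over shifts *)

Lemma sum_nat_mul (q P : nat) (F : nat -> nat) :
  \sum_(0 <= k < P * q) F k = \sum_(0 <= B < P) \sum_(0 <= t < q) F (B * q + t).
Proof.
rewrite big_nat_mul; apply: eq_bigr => B _.
rewrite mulSn -{1}[B * q]add0n big_addn addnK.
by apply: eq_bigr => t _; rewrite addnC.
Qed.

Lemma minSl_leq (q : nat) (x : nat) (y : nat -> nat) :
  minn x (\sum_(0 <= t < q) y t) <= \sum_(0 <= t < q) minn x (y t).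
Proof.
by elim: q => [|q IHq]; [rewrite !big_geq ?minn0|rewrite !big_nat_recr //=; lia].
Qed.

Lemma min_sums_leq (q : nat) (x y : nat -> nat) :
  minn (\sum_(0 <= t < q) x t) (\sum_(0 <= t < q) y t)
    <= \sum_(0 <= t < q) \sum_(0 <= t' < q) minn (x t) (y t').
Proof.
rewrite minnC; apply: leq_trans (minSl_leq _ _ _) _.
apply: leq_sum => t _; rewrite minnC; exact: minSl_leq.
Qed.

(** Group the pairs by their distance d; the diagonal is counted twice, hence only an inequality. *)
Lemma pair_sum_shifts (q : nat) (m : nat -> nat -> nat) :
  \sum_(0 <= t < q) \sum_(0 <= t' < q) m t t' <=
  \sum_(0 <= d < q) \sum_(0 <= t < q - d) (m t (t + d) + m (t + d) t).
Proof.
elim: q => [|q IHq]; first by rewrite !big_geq.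
have -> : \sum_(0 <= t < q.+1) \sum_(0 <= t' < q.+1) m t t' =
    \sum_(0 <= t < q) \sum_(0 <= t' < q) m t t' +
    (\sum_(0 <= t < q) m t q + \sum_(0 <= t < q.+1) m q t).
  rewrite big_nat_recr //= addnA; congr (_ + _).
  by rewrite -big_split; apply: eq_bigr => t _; rewrite big_nat_recr.
have -> : \sum_(0 <= d < q.+1) \sum_(0 <= t < q.+1 - d) (m t (t + d) + m (t + d) t) =
    \sum_(0 <= d < q) \sum_(0 <= t < q - d) (m t (t + d) + m (t + d) t) +
    \sum_(0 <= d < q.+1) (m (q - d) q + m q (q - d)).
  rewrite [in RHS]big_nat_recr //= addnA big_nat_recr //= subSnn subnn big_nat1.
  congr (_ + _); rewrite -big_split /=; apply: eq_big_nat => d /andP[_ lt_dq].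
  by rewrite subSn 1?ltnW // big_nat_recr //= subnK // ltnW.
apply: (leq_add IHq); rewrite big_split /=.
have rev (f : nat -> nat) : \sum_(0 <= d < q.+1) f (q - d) = \sum_(0 <= d < q.+1) f d.
  by rewrite [RHS]big_nat_rev.
by rewrite (rev (m^~ q)) (rev (m q)) leq_add2r [leqRHS]big_nat_recr //= leq_addr.
Qed.

(** The indices [B * q + t] with [t < q - d] are distinct and below [P * q - d]. *)
Lemma blocks_shift (q P d : nat) (f : nat -> nat) : d < q ->
  \sum_(0 <= B < P) \sum_(0 <= t < q - d) f (B * q + t) <=
    \sum_(0 <= k < P * q - d) f k.
Proof.
move=> lt_dq; elim: P => [|P IHP]; first by rewrite big_geq.
rewrite big_nat_recr //= [leqRHS](@big_cat_nat _ _ _ (P * q)) //=; last first.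
  by rewrite mulSn; lia.
apply: leq_add.
  apply: leq_trans IHP _; rewrite [leqRHS](@big_cat_nat _ _ _ (P * q - d)) ?leq_subr //=.
  exact: leq_addr.
rewrite -[in leqRHS](add0n (P * q)) big_addn.
have -> : P.+1 * q - d - P * q = q - d by rewrite mulSn; lia.
by apply: leq_sum => t _; rewrite addnC.
Qed.

(* Any two sub-blocks of one block are aligned by a shift of fewer than q
   sub-blocks, in one direction or the other; so sum over all such shifts. *)
Lemma sum_min_block_excess (x y : nat -> nat) (l q P G : nat) :
    (forall d, d <= P * q -> \sum_(0 <= k < P * q - d)
        minn (excess x l k) (excess y l (k + d)) <= G + d * l) ->
    (forall d, d <= P * q -> \sum_(0 <= k < P * q - d)
        minn (excess y l k) (excess x l (k + d)) <= G + d * l) ->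
  \sum_(0 <= B < P) minn (block_excess x l q B) (block_excess y l q B) <=
    2 * q * (G + q * l).
Proof.
(* Once P is positive, every shift [d < q] satisfies [d <= P * q]. *)
move=> xy yx; case: P xy yx => [|P] xy yx; first by rewrite big_geq.
pose m B t t' := minn (excess x l (B * q + t)) (excess y l (B * q + t')).
have -> : 2 * q * (G + q * l) = \sum_(0 <= d < q) (2 * (G + q * l)).
  rewrite sum_nat_const_nat; lia.
apply: (@leq_trans (\sum_(0 <= d < q) \sum_(0 <= B < P.+1) \sum_(0 <= t < q - d)
    (m B t (t + d) + m B (t + d) t))).
  rewrite exchange_big /=; apply: leq_sum => B _.
  apply: leq_trans (min_sums_leq _ _ _) _; exact: (pair_sum_shifts q (m B)).
rewrite !big_nat; apply: leq_sum => d /andP[_ lt_dq].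
have le_d : d <= P.+1 * q by rewrite mulSn; lia.
have le_dl : d * l <= q * l by rewrite leq_mul2r (ltnW lt_dq) orbT.
under eq_bigr do rewrite big_split /=.
rewrite big_split mul2n -addnn; apply: leq_add.
  apply: leq_trans (leq_trans _ (xy d le_d)) _; last by rewrite leq_add2l.
  pose f k := minn (excess x l k) (excess y l (k + d)).
  apply: leq_trans (blocks_shift P.+1 f lt_dq).
  by apply: leq_sum => B _; apply: leq_sum => t _; rewrite /m /f addnA.
apply: leq_trans (leq_trans _ (yx d le_d)) _; last by rewrite leq_add2l.
pose f k := minn (excess y l k) (excess x l (k + d)).
apply: leq_trans (blocks_shift P.+1 f lt_dq).
by apply: leq_sum => B _; apply: leq_sum => t _; rewrite /m /f addnA minnC.
Qed.

(** * Descent through the scales *)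

(** This bounds the sum of all block excesses except the largest one. *)
Definition pair_excess (I : finType) (o : I -> nat -> nat) (l q B : nat) : nat :=
  \sum_(i : I) \sum_(j : I | j != i)
    minn (block_excess (o i) l q B) (block_excess (o j) l q B).

(* Sums [pair_excess] over all sub-blocks of lengths q, ..., q^(h+1) of the block
   of index B and length q^(h+1). *)
Fixpoint total_pair_excess (I : finType) (o : I -> nat -> nat) (q h B : nat) : nat :=
  pair_excess o (q ^ h) q B +
  if h is h'.+1 then \sum_(0 <= t < q) total_pair_excess o q h' (B * q + t) else 0.

Lemma sum_block_increments (o : nat -> nat) (l q B : nat) :
    {homo o : x y / x <= y} ->
  \sum_(0 <= t < q) (o ((B * q + t).+1 * l) - o ((B * q + t) * l)) =
    o (B.+1 * (q * l)) - o (B * (q * l)).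
Proof.
move=> mono_o; pose f t := o ((B * q + t) * l).
have -> : o (B.+1 * (q * l)) = f q by rewrite /f mulnA mulSn addnC.
have -> : o (B * (q * l)) = f 0 by rewrite /f addn0 mulnA.
rewrite -telescope_sumn.
  by apply: eq_bigr => t _; rewrite /f addnS.
by move=> t t' le_tt'; apply: mono_o; rewrite leq_mul2r leq_add2l le_tt' orbT.
Qed.

(** In each sub-block, deficit plus number of b's is at most excess plus l; summing, the numbers of
    b's telescope. *)
Lemma sum_deficit_leq (o : nat -> nat) (l q B : nat) :
    {homo o : x y / x <= y} ->
  \sum_(0 <= t < q) deficit o l (B * q + t) <=
    block_excess o l q B + deficit o (q * l) B.
Proof.
move=> mono_o; have incE := sum_block_increments l q B mono_o.
suff : \sum_(0 <= t < q) deficit o l (B * q + t) +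
    (o (B.+1 * (q * l)) - o (B * (q * l))) <= block_excess o l q B + q * l.
  by move=> le_sum; rewrite [in leqRHS]/deficit; lia.
rewrite -incE -[q in q * l]subn0 -sum_nat_const_nat -!big_split /=.
by apply: leq_sum => t _; rewrite /deficit /excess; lia.
Qed.

Lemma block_excess1 (o : nat -> nat) (q B : nat) : {homo o : x y / x <= y} ->
  block_excess o 1 q B = o (B.+1 * q) - o (B * q).
Proof.
move=> mono_o; rewrite -[q in RHS]muln1 -sum_block_increments //.
by apply: eq_bigr => t _; rewrite /excess subn1.
Qed.

(** Induction on h: drop the word of largest excess; the deficits of the others on the sub-blocks
    are paid for by [pair_excess] and their deficits on B. At [h = 0], two words remain and the
    excesses count their b's. *)
Lemma block_length_leq (I : finType) (o : I -> nat -> nat) (q h B : nat)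
    (W : {set I}) : (forall i, {homo o i : x y / x <= y}) -> h.+2 <= #|W| ->
  q ^ h.+1 <= \sum_(i in W) deficit (o i) (q ^ h.+1) B + total_pair_excess o q h B.
Proof.
move=> mono_o; elim: h B W => [|h IHh] B W cardW.
  have /card_gt1P [i [j [Wi Wj neq_ij]]] := cardW.
  rewrite expn1 /= expn0 addn0 (bigD1 i) //= (bigD1 j) /=; last by rewrite Wj eq_sym.
  have : minn (block_excess (o i) 1 q B) (block_excess (o j) 1 q B) <= pair_excess o 1 q B.
    rewrite /pair_excess (bigD1 i) //= (bigD1 j) /=; last by rewrite eq_sym.
    by rewrite -addnA leq_addr.
  by rewrite !block_excess1 // /deficit; lia.
have [t0 Wt0] : exists t, t \in W by apply/set0Pn; rewrite -card_gt0; lia.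
case: (arg_maxnP (fun i => block_excess (o i) (q ^ h.+1) q B) Wt0) => t Wt max_t.
pose W' := W :\ t.
have cardW' : h.+2 <= #|W'| by move: cardW; rewrite (cardsD1 t) (Wt : t \in W).
(* In a pair with t, the minimum is the excess of the other word. *)
have excessW' : \sum_(i in W') block_excess (o i) (q ^ h.+1) q B <=
    pair_excess o (q ^ h.+1) q B.
  rewrite /pair_excess [leqRHS](bigD1 t) //=; apply: leq_trans (leq_addr _ _).
  rewrite big_mkcond [leqRHS]big_mkcond; apply: leq_sum => i _.
  rewrite !inE; case: ifP => // /andP[neq_it Wi].
  by rewrite neq_it leq_min leqnn andbT; apply: max_t.
have le_sub : \sum_(0 <= u < q) q ^ h.+1 <=
    \sum_(0 <= u < q) (\sum_(i in W') deficit (o i) (q ^ h.+1) (B * q + u) +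
      total_pair_excess o q h (B * q + u)) by apply: leq_sum => u _; exact: IHh.
rewrite expnS -[q in q * _ <= _]subn0 -sum_nat_const_nat /= addnA.
apply: leq_trans le_sub _; rewrite big_split leq_add2r /=.
rewrite exchange_big /=.
apply: (@leq_trans (\sum_(i in W') (block_excess (o i) (q ^ h.+1) q B +
    deficit (o i) (q * q ^ h.+1) B))).
  by apply: leq_sum => i _; exact: sum_deficit_leq.
rewrite big_split /= addnC leq_add //.
rewrite [leqRHS](bigD1 t) //=.
by under [X in _ <= _ + X]eq_bigl do rewrite andbC -in_setD1; rewrite leq_addl.
Qed.

(** Each of the [h + 1] scales contributes at most S. *)
Lemma sum_total_pair_excess (I : finType) (o : I -> nat -> nat) (q h P S : nat) :
    (forall u n, u <= h -> n * q ^ u.+1 <= P * q ^ h.+1 ->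
       \sum_(0 <= B < n) pair_excess o (q ^ u) q B <= S) ->
  \sum_(0 <= B < P) total_pair_excess o q h B <= h.+1 * S.
Proof.
elim: h P => [|h IHh] P bound.
  by under eq_bigr do rewrite /= addn0; rewrite mul1n; apply: bound.
rewrite big_split mulSn; apply: leq_add; first exact: bound.
rewrite -sum_nat_mul; apply: IHh => u n le_uh le_n.
by apply: bound; [exact: leqW|rewrite [q ^ h.+2]expnS mulnA].
Qed.

(** Here [h = r - 2], and [o i z] counts the b's of word i before its a of index z. Summing
    [block_length_leq] over P blocks of length L gives [P * L] at most a quarter of itself, from the
    deficits, plus nine sixteenths, from the pair excesses. *)
Lemma no_small_pairwise_gain (I : finType) (o : I -> nat -> nat) (q h M G : nat) :
    0 < q -> #|I| = h + 4 -> 8 * #|I| * G <= q ^ h.+1 ->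
    4 * #|I| ^ 3 * q ^ h.+2 <= M ->
    (forall i, {homo o i : x y / x <= y}) ->
    (forall i j l K d, i != j -> 0 < l -> K * l <= M -> d <= K ->
       \sum_(0 <= k < K - d) minn (excess (o i) l k) (excess (o j) l (k + d))
         <= G + d * l) ->
    (forall i j z, i != j -> z <= M -> minn (o i z) (o j z) <= z + G) ->
    (forall i j z, i != j -> z <= M -> z <= maxn (o i z) (o j z) + G) ->
  False.
Proof.
set T := #|I| => q_gt0 cardI smallG largeM mono_o shift_le high_le low_le.
pose L := q ^ h.+1; pose P := 4 * T ^ 3 * q.
have le_PL : P * L <= M by rewrite /P /L -mulnA -expnS.
pose S := T * (T * (2 * q * (G + L))).
have pair_le u n : u <= h -> n * q ^ u.+1 <= P * q ^ h.+1 ->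
    \sum_(0 <= B < n) pair_excess o (q ^ u) q B <= S.
  move=> le_uh le_n; rewrite exchange_big /= /S -sum_nat_const.
  apply: leq_sum => i _; rewrite exchange_big /=.
  apply: (@leq_trans (\sum_(j : I | j != i) 2 * q * (G + L))); last first.
    by rewrite sum_nat_const leq_mul2r max_card orbT.
  apply: leq_sum => j neq_ji.
  have le_nM : n * q * q ^ u <= M.
    by rewrite -mulnA -expnS; apply: leq_trans le_n le_PL.
  apply: (@leq_trans (2 * q * (G + q * q ^ u))).
    apply: sum_min_block_excess => d le_d; apply: shift_le;
      by rewrite // ?expn_gt0 ?q_gt0 // eq_sym.
  by rewrite leq_mul2l leq_add2l -expnS leq_pexp2l ?orbT.
have block_le B : B < P -> L <= T * (2 * G) + total_pair_excess o q h B.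
  move=> lt_BP.
  have le_hi : B.+1 * L <= M by apply: leq_trans le_PL; rewrite leq_mul2r lt_BP orbT.
  have le_lo : B * L <= M by apply: leq_trans le_hi; rewrite leq_mul2r leqnSn orbT.
  (* At most one word is more than G ahead at the start of the block, and at most one more than G
     behind at its end; any other has deficit at most [2 * G]. *)
  pose H := [set i | B * L + G < o i (B * L)].
  pose D := [set i | o i (B.+1 * L) + G < B.+1 * L].
  have cardH : #|H| <= 1.
    apply/card_le1_eqP => i j; rewrite !inE => Hi Hj; apply/eqP/negPn/negP => neq_ij.
    by have := high_le j i _ neq_ij le_lo; lia.
  have cardD : #|D| <= 1.
    apply/card_le1_eqP => i j; rewrite !inE => Di Dj; apply/eqP/negPn/negP => neq_ij.
    by have := low_le j i _ neq_ij le_hi; lia.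
  pose W := ~: (H :|: D).
  have cardW : h.+2 <= #|W|.
    have := cardsC (H :|: D); have := (leq_card_setU H D).1; rewrite -/T -/W cardI; lia.
  apply: leq_trans (block_length_leq q B mono_o cardW) _; rewrite leq_add2r.
  apply: (@leq_trans (\sum_(i in W) 2 * G)).
    apply: leq_sum => i; rewrite !inE negb_or -!leqNgt /deficit -/L => /andP[].
    by rewrite mulSn; lia.
  by rewrite sum_nat_const leq_mul2r max_card orbT.
have total : P * L <= P * (T * (2 * G)) + h.+1 * S.
  rewrite -[P in P * L]subn0 -[P in P * (T * _)]subn0 -!sum_nat_const_nat.
  apply: (@leq_trans (\sum_(0 <= B < P) (T * (2 * G) + total_pair_excess o q h B))).
    by rewrite !big_nat; apply: leq_sum => B /andP[_]; exact: block_le.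
  by rewrite big_split leq_add2l; apply: sum_total_pair_excess.
have L_gt0 : 0 < L by rewrite expn_gt0 q_gt0.
have T_gt0 : 0 < T by rewrite cardI addn4.
have le_hT : h.+1 <= T by rewrite cardI addn4; lia.
have smallG' : 8 * (T * G) <= L by rewrite mulnA.
have leGL : 8 * G <= L by apply: leq_trans smallG'; rewrite leq_mul2l leq_pmull ?orbT.
have leS : 8 * S <= T * (T * (18 * q * L)).
  have -> : 8 * S = T * (T * (2 * q * (8 * G + 8 * L))) by rewrite /S; lia.
  have -> : 18 * q * L = 2 * q * (9 * L) by lia.
  by rewrite !leq_mul2l; apply/orP; right; apply/orP; right; apply/orP; right; lia.
have le1 : 8 * (P * (T * (2 * G))) <= P * (2 * L).
  have -> : 8 * (P * (T * (2 * G))) = P * (2 * (8 * (T * G))) by lia.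
  by rewrite !leq_mul2l smallG' !orbT.
have le2 : 8 * (h.+1 * S) <= T * (T * (T * (18 * q * L))).
  have -> : 8 * (h.+1 * S) = h.+1 * (8 * S) by lia.
  exact: leq_mul.
have PE : P * L = 4 * (T * (T * (T * (q * L)))) by rewrite /P !expnS expn0; lia.
have X_gt0 : 0 < T * (T * (T * (q * L))) by rewrite !muln_gt0 T_gt0 q_gt0 L_gt0.
have E2 : T * (T * (T * (18 * q * L))) = 18 * (T * (T * (T * (q * L)))) by lia.
have E1 : P * (2 * L) = 2 * (P * L) by lia.
lia.
Qed.

(** * Words with many a's and b's *)

Lemma LCS_sym_leq (T : finType) (w w' : seq T) : LCS w' w <= LCS w w'.
Proof.
apply/bigmax_leqP => m /existsP[s /andP[sw' sw]].
by rewrite -(size_tuple s) leq_LCS.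
Qed.

(** Two encodings start with the same letter, so the words share either one b and M a's, or one a
    and M b's. *)
Lemma three_words_LCS (I T : finType) (a b : T) (v : I -> seq T) (M : nat) :
    a != b -> 2 < #|I| -> 0 < M ->
    (forall i, M <= count_mem a (v i)) -> (forall i, M <= count_mem b (v i)) ->
  exists i j, i != j /\ M < LCS (v i) (v j).
Proof.
move=> neq_ab cardI M_gt0 count_a count_b.
have /fin_all_exists [g0 /fin_all_exists [g enc]] i := exists_encode (v i) neq_ab.
pose S := [set i | 0 < g0 i].
have same i j : i != j -> (i \in S) = (j \in S) ->
    exists i j, i != j /\ M < LCS (v i) (v j).
  move=> neq_ij; rewrite !inE => eq_ij; exists i, j; split=> //.
  have [[sub_i ones_i] [sub_j ones_j]] := (enc i, enc j).
  have [gi0|gi_gt0] := posnP (g0 i); last first.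
    have gj_gt0 : 0 < g0 j by rewrite -eq_ij.
    have := LCS_ones_zeros sub_i sub_j (count_a i) (count_a j) (leq0n M).
    by rewrite /ones !big_geq // !addn0; lia.
  have gj0 : g0 j = 0 by move: eq_ij; rewrite gi0; case: (g0 j).
  have sub i' : g0 i' = 0 -> subseq (a :: nseq M b) (v i').
    move=> gi'0; have [sub_v ones_v] := enc i'; apply: subseq_trans sub_v.
    rewrite /encode gi'0 /=.
    apply: subseq_trans (cons_nseq_subseq_cells _ _ _ _ (leq_trans M_gt0 (count_a i'))).
    rewrite /= eqxx; apply: subseq_nseq_leq (subseq_refl _).
    by rewrite add0n; have := count_b i'; rewrite -ones_v /ones gi'0 add0n.
  by have := leq_LCS (sub i gi0) (sub j gj0); rewrite /= size_nseq.
have [/card_gt1P [i [j [Si Sj neq_ij]]]|cardS] := ltnP 1 #|S|.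
  by apply: (same i j) => //; rewrite Si Sj.
have /card_gt1P [i [j [Si Sj neq_ij]]] : 1 < #|~: S| by have := cardsC S; lia.
by apply: (same i j) => //; move: Si Sj; rewrite !in_setC => /negPf -> /negPf ->.
Qed.

Lemma words_LCS (I T : finType) (a b : T) (v : I -> seq T) (r q M G : nat) :
    a != b -> 0 < r -> 0 < q -> #|I| = r + 2 ->
    8 * (r + 2) * G <= q ^ r.-1 -> 4 * (r + 2) ^ 3 * q ^ r <= M ->
    (forall i, M <= count_mem a (v i)) -> (forall i, M <= count_mem b (v i)) ->
  exists i j, i != j /\ M + G < LCS (v i) (v j).
Proof.
move=> neq_ab r_gt0 q_gt0 cardI smallG largeM count_a count_b.
case: r r_gt0 cardI smallG largeM => // -[|h] _ cardI smallG largeM.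
  (* For [r = 1], [smallG] reads [24 * G <= 1]. *)
  have -> : G = 0 by move: smallG; rewrite expn0; lia.
  rewrite addn0; apply: (three_words_LCS neq_ab) => //; first by rewrite cardI.
  by apply: leq_trans largeM; rewrite !muln_gt0 !expn_gt0 q_gt0.
have /fin_all_exists [g0 /fin_all_exists [g enc]] i := exists_encode (v i) neq_ab.
case: (boolP [exists i, exists j, (i != j) && (M + G < LCS (v i) (v j))]).
  by move=> /existsP[i /existsP[j /andP[neq_ij lt_LCS]]]; exists i, j.
move=> small; exfalso; have {small} LCS_le i j : i != j -> LCS (v i) (v j) <= M + G.
  move=> neq_ij; rewrite leqNgt; apply: contra small => lt_LCS.
  by apply/existsP; exists i; apply/existsP; exists j; rewrite neq_ij.
have sub i : subseq (encode a b (g0 i) (g i) (count_mem a (v i))) (v i) by case: (enc i).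
have ones_ge i : M <= ones (g0 i) (g i) (count_mem a (v i)) by case: (enc i) => _ ->.
have cardI' : #|I| = h + 4 by rewrite cardI; lia.
apply: (@no_small_pairwise_gain I (fun i => ones (g0 i) (g i)) q h M G) => //.
- by rewrite cardI.
- by rewrite cardI.
- by move=> i; exact: homo_ones.
- move=> i j l K d neq_ij l_gt0 le_KM le_dK.
  have := LCS_shifted_blocks (sub i) (sub j) (count_a i) (count_a j) l_gt0 le_KM le_dK.
  have := LCS_le i j neq_ij; lia.
- move=> i j z neq_ij le_zM.
  have := LCS_ones_zeros (sub i) (sub j) (count_a i) (count_a j) le_zM.
  have := LCS_le i j neq_ij; lia.
move=> i j z neq_ij le_zM.
have := LCS_zeros_ones (sub i) (sub j) (count_a i) (count_a j)
  (ones_ge i) (ones_ge j) le_zM.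
have := LCS_le i j neq_ij; lia.
Qed.

(** * Reduction from k letters to two *)

Lemma size_sum_count (T : finType) (w : seq T) : size w = \sum_(a : T) count_mem a w.
Proof.
elim: w => [|x w IHw]; first by rewrite big1.
rewrite /= big_split /= -IHw (bigD1 x) //= eqxx big1 // => y.
by rewrite eq_sym => /negPf ->.
Qed.

Lemma LCS_multiset_geq (k r n q G : nat) (W : (r + k + 2).-tuple (n.-tuple 'I_k)) :
    1 < k -> 0 < r -> 0 < q -> 8 * (r + 2) * G <= q ^ r.-1 ->
    8 * (r + 2) ^ 3 * q ^ r * k <= n ->
  n + G < k * LCS_multiset W.
Proof.
move=> k_gt1 r_gt0 q_gt0 smallG largen; set U := LCS_multiset W.
rewrite ltnNge; apply/negP => smallU.
have LCS_le i j : i != j -> LCS (tnth W i) (tnth W j) <= U.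
  wlog lt_ij : i j / i < j => [wlog_ij neq_ij|_].
    case: (ltngtP i j) => [lt_ij|lt_ji|/val_inj eq_ij]; first exact: wlog_ij.
      by apply: leq_trans (LCS_sym_leq _ _) _; apply: wlog_ij; rewrite 1?eq_sym.
    by rewrite eq_ij eqxx in neq_ij.
  rewrite /U /LCS_multiset; apply: (bigop.bigmax_sup i) => //.
  exact: (bigop.bigmax_sup j).
pose a0 : 'I_k := Ordinal (ltnW k_gt1).
(* An overfull letter of word i; the default occurs only outside [bad]. Two words with the same
   overfull letter would share [U + 1] copies of it, so f is injective on [bad]. *)
pose f i := odflt a0 [pick a | U < count_mem a (tnth W i)].
pose bad := [set i | [exists a, U < count_mem a (tnth W i)]].
have f_bad i : i \in bad -> U < count_mem (f i) (tnth W i).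
  rewrite inE /f => /existsP[a Ua]; case: pickP => [//|none].
  by have := none a; rewrite Ua.
have card_bad : #|bad| <= k.
  rewrite -(card_in_imset (f := f)); first by rewrite -[leqRHS]card_ord max_card.
  move=> i j /f_bad fi /f_bad fj eq_f; apply/eqP/negPn/negP => neq_ij.
  have sub i' : U < count_mem (f i) (tnth W i') -> subseq (nseq U.+1 (f i)) (tnth W i').
    move=> lt_U; apply: subseq_nseq_leq lt_U _.
    by rewrite -size_filter -(all_pred1P _ _ (filter_all _ _)) filter_subseq.
  rewrite -eq_f in fj.
  have := leq_LCS (sub i fi) (sub j fj); rewrite size_nseq.
  by rewrite ltnNge LCS_le.
have card_good : r + 2 <= #|~: bad|.
  by have := cardsC bad; rewrite card_ord; lia.
pose h (i : 'I_(r + 2)) := enum_val (widen_ord card_good i).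
have h_inj : injective h by move=> i j /enum_val_inj/(congr1 val) eq_ij; apply: val_inj.
have h_good i a : count_mem a (tnth W (h i)) <= U.
  have := enum_valP (widen_ord card_good i); rewrite -/(h i) !inE negb_exists.
  by move=> /forallP/(_ a); rewrite -leqNgt.
have count_ge i a : n - k.-1 * U <= count_mem a (tnth W (h i)).
  rewrite leq_subLR -[n in n <= _](size_tuple (tnth W (h i))) size_sum_count.
  rewrite (bigD1 a) //= addnC leq_add2r.
  apply: (@leq_trans (\sum_(c < k | c != a) U)).
    by apply: leq_sum => c _; exact: h_good.
  rewrite sum_nat_const leq_mul2r; apply/orP; right.
  by have := cardC1 a; rewrite card_ord => <-.
pose X := (r + 2) ^ 3 * q ^ r.
have le_GX : G <= X.
  apply: (@leq_trans (q ^ r.-1)).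
    by apply: leq_trans smallG; rewrite leq_pmull ?muln_gt0 ?addn2.
  apply: (@leq_trans (q ^ r)); first by rewrite leq_pexp2l // leq_pred.
  by rewrite leq_pmull // expn_gt0 addn2.
have le_Xn : 8 * (X * k) <= n by apply: leq_trans largen; rewrite /X; lia.
have k_gt0 : 0 < k by exact: ltnW.
have le_GXk : G * k <= X * k by rewrite leq_mul2r le_GX orbT.
have kE : k * U = U + k.-1 * U by rewrite -{1}(prednK k_gt0) mulSn.
(* After multiplication by k, this follows from [k * U <= n + G], [8 * X * k <= n] and [G <= X]. *)
have largeM : k.-1 * U + 4 * X <= n.
  rewrite -(leq_pmul2l k_gt0).
  have : k.-1 * (k * U) <= k.-1 * (n + G) by rewrite leq_mul2l smallU orbT.
  rewrite (_ : k.-1 * (n + G) = k * (n + G) - (n + G)); last first.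
    by rewrite -{2}(prednK k_gt0) mulSn addKn.
  rewrite !mulnDr; lia.
have neq01 : a0 != Ordinal k_gt1 by [].
have [|i [j [neq_ij]]] := @words_LCS _ _ _ _ (fun i => tnth W (h i)) r q (n - k.-1 * U) G
    neq01 r_gt0 q_gt0 (card_ord _) smallG _ (fun i => count_ge i _) (fun i => count_ge i _).
  by rewrite -mulnA -/X; lia.
have : LCS (tnth W (h i)) (tnth W (h j)) <= U by apply: LCS_le; rewrite (inj_eq h_inj).
lia.
Qed.

Lemma LCS_multiset_leq (T : finType) (n t : nat) (W : t.-tuple (n.-tuple T)) :
  LCS_multiset W <= n.
Proof.
apply/bigmax_leqP => i _; apply/bigmax_leqP => j _; apply/bigmax_leqP => m _.
by rewrite -ltnS -[n in _ < n.+1](size_tuple (tnth W i)) ltn_ord.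
Qed.

(** * Choice of q and the real estimate *)

(** Bernoulli-type bound; the induction uses [(q + 1) * (q - m - 1) <= q * (q - m)]. *)
Lemma expSn_sub_leq (q m : nat) : m <= q -> q.+1 ^ m * (q - m) <= q ^ m.+1.
Proof.
elim: m => [|m IHm] le_mq; first by rewrite expn0 subn0 mul1n expn1.
rewrite expnSr -mulnA; apply: (@leq_trans (q.+1 ^ m * (q * (q - m)))).
  rewrite leq_mul2l; apply/orP; right.
  have -> : q - m = (q - m.+1).+1 by lia.
  by rewrite mulnS mulSn leq_add2r leq_subr.
by rewrite mulnCA [leqRHS]expnS leq_mul2l IHm ?orbT // ltnW.
Qed.

Lemma expSn_leq_double (q m : nat) : 2 * m <= q -> q.+1 ^ m <= 2 * q ^ m.
Proof.
case: q => [|q] le_mq; first by case: m le_mq.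
have le_mq1 : m <= q.+1 by lia.
rewrite -(leq_pmul2l (ltn0Sn q)) mulnCA -expnS.
apply: leq_trans (leq_mul (leqnn 2) (expSn_sub_leq le_mq1)).
by rewrite mulnC mulnCA leq_mul2l; apply/orP; right; lia.
Qed.

(** Take the largest q allowed by n; the lower bound on n makes [2 * r] admissible. *)
Lemma exists_block_ratio (k r n : nat) : 0 < k -> 0 < r ->
    k * (10 * r) ^ (9 * r) <= n ->
  exists q, [/\ 2 * r <= q, 8 * (r + 2) ^ 3 * q ^ r * k <= n &
    n < 8 * (r + 2) ^ 3 * q.+1 ^ r * k].
Proof.
move=> k_gt0 r_gt0 le_n.
pose P q := 8 * (r + 2) ^ 3 * q ^ r * k <= n.
have P2r : P (2 * r).
  apply: leq_trans le_n; rewrite mulnC leq_mul2l; apply/orP; right.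
  rewrite (_ : 9 * r = 8 * r + r); last lia.
  rewrite expnD; apply: leq_mul; last by rewrite leq_exp2r // leq_mul2r orbT.
  apply: (@leq_trans ((10 * r) ^ 3)); last by rewrite leq_pexp2l ?muln_gt0 //; lia.
  rewrite (_ : 8 = 2 ^ 3) // -expnMn leq_exp2r //; lia.
have bound q : P q -> q <= n.
  move=> Pq; apply: leq_trans Pq; rewrite mulnAC.
  case: q => // q; apply: (@leq_trans (q.+1 ^ r)).
    by rewrite -[leqLHS]expn1 leq_pexp2l.
  by rewrite leq_pmull // !muln_gt0 k_gt0 addn2.
have exP : exists q, P q by exists (2 * r).
case: (ex_maxnP exP bound) => q Pq max_q.
exists q; split=> //; first exact: max_q.
by rewrite ltnNge; apply/negP => /max_q; rewrite ltnn.
Qed.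

Local Open Scope ring_scope.

(** With [y = n / k], the left side is [y ^ (1 - 1/r) / k] up to the factor in r. Maximality of q
    bounds y, and [2 * r <= q] lets q replace [q + 1] at the cost of a factor 2. The constant is
    [10368 = 16 * 8 * 3 ^ 4], from [r + 2 <= 3 * r]. *)
Lemma target_gain_leq (R : realType) (k r n q G : nat) :
    (0 < k)%N -> (0 < r)%N -> (2 * r <= q)%N ->
    (n < 8 * (r + 2) ^ 3 * q.+1 ^ r * k)%N ->
    (q ^ r.-1 < 8 * (r + 2) * G.+1)%N ->
  10368^-1 * r%:R ^- 9 * k%:R `^ (1 / r%:R - 2) * n%:R `^ (1 - 1 / r%:R)
    <= G.+1%:R / k%:R :> R.
Proof.
move=> k_gt0 r_gt0 le_rq lt_n lt_q.
set K : R := k%:R; set p : R := 1 / r%:R.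
have K_gt0 : 0 < K by rewrite ltr0n.
have r_gt0R : 0 < r%:R :> R by rewrite ltr0n.
have p_gt0 : 0 < p by rewrite divr_gt0.
have p_le1 : p <= 1 by rewrite ler_pdivrMr // mul1r ler1n.
pose y : R := n%:R / K; pose e : R := (8 * (r + 2) ^ 3)%:R.
have y_ge0 : 0 <= y by rewrite divr_ge0.
have e_ge1 : 1 <= e by rewrite ler1n muln_gt0 expn_gt0 addn2.
have e_ge0 : 0 <= e := le_trans ler01 e_ge1.
have powE : K `^ (p - 2) * n%:R `^ (1 - p) = y `^ (1 - p) / K.
  have -> : n%:R = y * K by rewrite /y divfK // gt_eqF.
  rewrite powRM // ?ltW // mulrCA -powRD; last by rewrite (gt_eqF K_gt0) implybT.
  rewrite (_ : p - 2 + (1 - p) = - 1); last by ring.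
  by rewrite powRN powRr1 // ltW.
have y_le : y <= q.+1%:R ^+ r * e.
  rewrite ler_pdivrMr // -natrX /e /K -!natrM ler_nat.
  by rewrite (mulnC (_ ^ r)%N) ltnW.
have powy : y `^ (1 - p) <= q.+1%:R ^+ r.-1 * e.
  apply: (@le_trans _ _ ((q.+1%:R ^+ r * e) `^ (1 - p))).
    by apply: ge0_ler_powR; rewrite ?nnegrE ?subr_ge0 // (le_trans y_ge0).
  rewrite powRM ?exprn_ge0 //.
  apply: ler_pM; rewrite ?powR_ge0 //.
    rewrite -powR_mulrn // -powRrM.
    have -> : r%:R * (1 - p) = r.-1%:R.
      by rewrite -subn1 natrB // /p; field; rewrite gt_eqF.
    by rewrite powR_mulrn.
  by rewrite -[leRHS]powRr1 ?ler_powR //; lra.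
have le_G : (q.+1 ^ r.-1 <= 16 * (r + 2) * G.+1)%N.
  have := @expSn_leq_double q r.-1; lia.
have pow_le : q.+1%:R ^+ r.-1 * e <= 10368 * r%:R ^+ 4 * G.+1%:R.
  rewrite -!natrX -!natrM ler_nat.
  apply: (@leq_trans (16 * (r + 2) * G.+1 * (8 * (r + 2) ^ 3))).
    by rewrite leq_mul2r le_G orbT.
  rewrite (_ : (16 * _ * _ * _ = 128 * (r + 2) ^ 4 * G.+1)%N); last first.
    by rewrite !expnS expn0; lia.
  rewrite leq_mul2r; apply/orP; right.
  have -> : (10368 * r ^ 4 = 128 * (3 * r) ^ 4)%N by rewrite expnMn mulnA.
  by rewrite leq_mul2l leq_exp2r //; lia.
rewrite -mulrA powE mulrA ler_pM2r ?invr_gt0 //.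
have le_y := le_trans powy pow_le.
rewrite -mulrA ler_pdivrMl // ler_pdivrMl ?exprn_gt0 //.
apply: le_trans le_y _; rewrite (mulrC 10368) -mulrA ler_pM2r ?mulr_gt0 //.
by rewrite ler_weXn2l // ler1n.
Qed.

Unset Implicit Arguments.
Set Strict Implicit.

Theorem theorem1 (R : realType) :
  exists C1 C2 : R, [/\ 0 < C1, C1 <= C2 &
    forall k r n : nat,
      (2 <= k)%N -> (1 <= r)%N -> (k * (10 * r) ^ (9 * r) <= n)%N ->
      exists c : R,
        [/\ C1 * r%:R ^- 9 * k%:R `^ (1 / r%:R - 2) <= c,
            c <= C2 * r%:R ^- 9 * k%:R `^ (1 / r%:R - 2) &
            n%:R / k%:R + c * n%:R `^ (1 - 1 / r%:R)
              <= (LCS_family (r + k + 2) (words k n))%:R]].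
Proof.
exists 10368^-1, 10368^-1; split=> [||k r n]; rewrite ?invr_gt0 // => k_gt1 r_gt0 le_n.
eexists; split; [exact: lexx|exact: lexx|].
have k_gt0 := ltnW k_gt1.
have [q [le_rq le_qn lt_nq]] := exists_block_ratio k_gt0 r_gt0 le_n.
pose D := (8 * (r + 2))%N; pose G := (q ^ r.-1 %/ D)%N.
have D_gt0 : (0 < D)%N by rewrite muln_gt0 addn2.
have smallG : (D * G <= q ^ r.-1)%N by rewrite mulnC leq_divM.
have largeG : (q ^ r.-1 < D * G.+1)%N by rewrite mulnC ltn_ceil.
have q_gt0 : (0 < q)%N by lia.
have bound (W : (r + k + 2).-tuple (n.-tuple 'I_k)) :
    n%:R / k%:R + 10368^-1 * r%:R ^- 9 * k%:R `^ (1 / r%:R - 2) *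
      n%:R `^ (1 - 1 / r%:R) <= (LCS_multiset W)%:R :> R.
  (* The strict inequality of [LCS_multiset_geq] supplies [G + 1], a positive gain even when
     [G = 0]. *)
  apply: le_trans (lerD (lexx _) (target_gain_leq R k_gt0 r_gt0 le_rq lt_nq largeG)) _.
  rewrite -mulrDl ler_pdivrMr ?ltr0n // -natrD -natrM ler_nat mulnC addnS.
  exact: LCS_multiset_geq smallG le_qn.
rewrite /LCS_family; elim/big_ind: _ => [|x y le_x le_y|W _]; last exact: bound.
  (* The default n of the minimum also satisfies the bound, since some family exists and its LCS is
     at most n. *)
  pose W := [tuple [tuple Ordinal k_gt0 | _ < n] | _ < r + k + 2].
  by apply: le_trans (bound W) _; rewrite ler_nat LCS_multiset_leq.
by rewrite /minn; case: ifP.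
Qed.
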